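(* Let $p$ be a prime and let $G$ be a finite powerful $p$-group. Then $|G:G^{p^i}|=|\Omega_{\{i\}}(G)|$ for all integers $i\ge 0$.
   Context: For a group $G$ and $n\ge 1$, $G^n$ denotes the subgroup generated by all $n$-th powers of elements of $G$. A finite $p$-group $G$ is powerful if $[G,G]\le G^p$ when $p$ is odd, and $[G,G]\le G^4$ when $p=2$. For $i\ge 0$, $\Omega_{\{i\}}(G)$ denotes the set (not necessarily a subgroup) of all elements of $G$ of order at most $p^i$. *)

(* Defs.v *)
From mathcomp Require Import all_boot all_fingroup all_solvable.

Set Implicit Arguments.
Unset Strict Implicit.
Unset Printing Implicit Defensive.

Local Open Scope group_scope.

(* 'Mho^i(G) is not used: it raises each element to a power of a prime read off
   from that element's order, and agrees with G^{p^i} only for p-groups. *)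
Definition power_subgroup (gT : finGroupType) (A : {set gT}) (n : nat) :
  {set gT} := <<[set x ^+ n | x in A]>>.

Canonical power_subgroup_group (gT : finGroupType) (A : {set gT}) (n : nat) :=
  Eval hnf in [group of power_subgroup A n].

(* Meant for p-groups with p prime; the two cases are p = 2 and p odd. *)
Definition powerful (p : nat) (gT : finGroupType) (G : {set gT}) : bool :=
  [~: G, G] \subset power_subgroup G (if p == 2 then 4 else p).

(* A plain set, in general not a subgroup, unlike 'Ohm_i(G). *)
Definition Omega_set (p i : nat) (gT : finGroupType) (G : {set gT}) :
  {set gT} := [set x in G | #[x] <= p ^ i].

(* Main.v *)
Require Import Defs.
From mathcomp Require Import all_boot all_fingroup all_solvable.

(** Write M for the subgroup G^p generated by p-th powers; for p-groups G^{p^i}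
    is 'Mho^i(G), so everything is stated with 'Mho.

    The proof has two layers.  The structural layer says that in a powerful
    p-group power maps behave as in an abelian group, up to one step of the
    power series: [M, G] is contained in M^p (in M^4 if p = 2)
    ([powerful_comm_Mho1]), so M is powerful; every element of G^{p^i} is a
    p^i-th power and (G^{p^i})^p = G^{p^(i+1)} ([powerful_Mho]); and
    x |-> x^{p^i} induces a surjective homomorphism from G to
    G^{p^i} / G^{p^(i+1)} ([powerful_expg_iter_mod]), whose kernel K therefore
    satisfies |K| |G^{p^i}| = |G| |G^{p^(i+1)}| ([power_kernelP]).

    The counting layer ([card_Omega_powerful]) is an induction on |G|.  A
    subgroup of a powerful group need not be powerful, but the subgroups <x>M
    are ([powerful_cycle_Mho1]); those with x outside M cover G if M < G, any
    two of them are equal or meet in M, and they are proper unless G is cyclic.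
    In the counting, M itself also enters as a smaller powerful group: by
    induction it has n = |M : M^{p^i}| elements of order at most p^i.  Elements
    of G of order at most p^i lie in K.  Conversely, for x in K outside M, the
    group H = <x>M has H^{p^i} = M^{p^i}, so by induction it has p n elements
    of order at most p^i, and n of these lie in M.  Hence the |K : M| cosets of
    M in K contain on average n such elements each, whence
    |Omega_i(G)| |M| = |K| n, and the formula for |K|
    gives |Omega_i(G)| |G^{p^i}| = |G|.  For abelian G the equality is the
    count of kernel and image of the endomorphism x |-> x^{p^i}. *)

Set Implicit Arguments.
Unset Strict Implicit.
Unset Printing Implicit Defensive.

Local Open Scope group_scope.

(** * Generalities on powers in p-groups *)

(** With this exponent e, a p-group is powerful when its commutators lie in
    'Mho^e: one condition covers both the odd primes and p = 2. *)
Definition power_depth (p : nat) : nat := (p == 2).+1.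

Lemma power_subgroup_Mho (p i : nat) (gT : finGroupType) (G : {group gT}) :
  p.-group G -> power_subgroup G (p ^ i)%N = 'Mho^i(G).
Proof. by move=> pG; rewrite (MhoE i pG). Qed.

Lemma powerfulE (p : nat) (gT : finGroupType) (G : {group gT}) :
  p.-group G -> powerful p G = ([~: G, G] \subset 'Mho^(power_depth p)(G)).
Proof.
move=> pG; rewrite -(power_subgroup_Mho _ pG) /powerful /power_depth.
by case: eqP => [->|_]; rewrite ?expn1.
Qed.

Lemma pgroup_expg_Mho (p i : nat) (gT : finGroupType) (G : {group gT}) x :
  p.-group G -> x \in G -> x ^+ (p ^ i) \in 'Mho^i(G).
Proof. by move=> pG Gx; apply: Mho_p_elt (mem_p_elt pG Gx). Qed.

Lemma pgroup_Mho_subP (p i : nat) (gT : finGroupType) (G H : {group gT}) :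
    p.-group G ->
  reflect {in G, forall x, x ^+ (p ^ i) \in H} ('Mho^i(G) \subset H).
Proof.
move=> pG; rewrite (MhoE i pG) gen_subG.
apply: (iffP subsetP) => [sGH x Gx | GH _ /imsetP[x Gx ->]]; last exact: GH.
by apply: sGH; apply: imset_f.
Qed.

(** The p^i-th powers only generate 'Mho^i(G); that in a powerful group they
    exhaust it is a theorem, whose proof needs this induction. *)
Lemma pgroup_Mho_ind (p i : nat) (gT : finGroupType) (G : {group gT})
    (P : pred gT) :
    p.-group G -> P 1 ->
    {in 'Mho^i(G) &, forall u v, P u -> P v -> P (u * v)} ->
    {in G, forall x, P (x ^+ (p ^ i))} ->
  {in 'Mho^i(G), forall u, P u}.
Proof.
move=> pG P1 PM PX; pose K := [set u in 'Mho^i(G) | P u].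
have gK : group_set K.
  apply/group_setP; split=> [|u v]; first by rewrite inE group1.
  by rewrite !inE => /andP[Mu Pu] /andP[Mv Pv]; rewrite groupM //= PM.
have sMK : 'Mho^i(G) \subset Group gK.
  apply/(pgroup_Mho_subP _ _ pG) => x Gx.
  by rewrite inE (pgroup_expg_Mho i pG) ?PX.
by move=> u /(subsetP sMK); rewrite inE => /andP[].
Qed.

Lemma commg_expgl_class2 (gT : finGroupType) (n : nat) (x y : gT) :
    commute x [~ [~ x, y], x] -> commute [~ x, y] [~ [~ x, y], x] ->
  [~ x ^+ n, y] = [~ x, y] ^+ n * [~ [~ x, y], x] ^+ 'C(n, 2).
Proof.
move=> cxz cyz; rewrite commgEl conjXg conjg_mulR expMg_Rmul //.
by rewrite -!mulgA mulKg.
Qed.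

(** * The commutator subgroup of the p-th powers with the group *)

(** Here [x, y] lies in M, so [x^p, y] = [x, y]^p [[x, y], x]^{p(p-1)/2} with
    central second factor.  The first factor is a p-th power of an element of
    M, hence trivial; the second is a power of [[x, y]^p, x], since p divides
    p(p-1)/2 for odd p. *)
Lemma Mho1_central_odd (p : nat) (gT : finGroupType) (G : {group gT}) :
    prime p -> odd p -> p.-group G -> [~: G, G] \subset 'Mho^1(G) ->
    'Mho^1('Mho^1(G)) \subset [1] -> [~: 'Mho^1(G), G] \subset 'C(G) ->
  'Mho^1(G) \subset 'C(G).
Proof.
move=> p_pr p_odd pG sG'M M1 cMG.
have pM := pgroupS (Mho_sub 1 G) pG.
apply/(pgroup_Mho_subP _ _ pG) => x Gx; rewrite expn1.
apply/centP=> y Gy; apply/commgP.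
set c := [~ x, y].
have Mc : c \in 'Mho^1(G) by rewrite (subsetP sG'M) ?mem_commg.
have Gc : c \in G by rewrite groupR.
have /centP cz : [~ c, x] \in 'C(G) by rewrite (subsetP cMG) ?mem_commg.
have Mp1 u : u \in 'Mho^1(G) -> u ^+ p = 1.
  by move=> Mu; have /(_ u Mu)/set1P := (pgroup_Mho_subP _ _ pM M1); rewrite expn1.
have zp1 : [~ c, x] ^+ p = 1.
  by rewrite -(commXg _ (commute_sym (cz c Gc))) Mp1 // comm1g.
rewrite commg_expgl_class2 -/c; try exact/commute_sym/cz; rewrite ?Mp1 // mul1g.
have /dvdnP[k ->] : p %| 'C(p, 2).
  by apply: prime_dvd_bin => //=; case: (p) p_odd p_pr => [|[|[|]]].
by rewrite mulnC expgM zp1 expg1n.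
Qed.

(** For p = 2 the exponent of the second factor in
    [x^2, y] = [x, y]^2 [[x, y], x] is 1, which is why commutators are required
    to lie in T = G^4.  One first shows that T is central: [M, G] is
    central of exponent dividing 4, so [g^4, y] = [g^2, y]^2 has square 1, hence
    [d, g]^2 = 1 for every d in T; taking d = [g, y] gives
    [g^2, y]^2 = d^4 [d, g]^2 = 1.  Then T is abelian and generated by the
    elements g^4, and g^8 = (g^2)^4 = 1, so T has exponent dividing 2 and both
    factors above vanish. *)
Lemma Mho1_central_even (gT : finGroupType) (G : {group gT}) :
    2.-group G -> [~: G, G] \subset 'Mho^2(G) ->
    'Mho^2('Mho^1(G)) \subset [1] -> [~: 'Mho^1(G), G] \subset 'C(G) ->
  'Mho^1(G) \subset 'C(G).
Proof.
move=> pG sG'T M1 cMG.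
have pM := pgroupS (Mho_sub 1 G) pG.
have sTM : 'Mho^2(G) \subset 'Mho^1(G) by apply: Mho_leq.
have M4 u : u \in 'Mho^1(G) -> u ^+ 4 = 1.
  by move=> Mu; have /(_ u Mu)/set1P := (pgroup_Mho_subP _ _ pM M1).
have cR u x y : u \in 'Mho^1(G) -> x \in G -> y \in G -> commute y [~ u, x].
  move=> Mu Gx Gy; apply/commute_sym/(centP (subsetP cMG _ _)) => //.
  exact: mem_commg.
have GM u : u \in 'Mho^1(G) -> u \in G by apply/subsetP/Mho_sub.
have Mx2 x : x \in G -> x ^+ 2 \in 'Mho^1(G).
  by move=> Gx; apply: (pgroup_expg_Mho 1 pG).
have Tx4 x : x \in G -> x ^+ 4 \in 'Mho^2(G).
  by move=> Gx; apply: (pgroup_expg_Mho 2 pG).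
have TR x y : x \in G -> y \in G -> [~ x, y] \in 'Mho^2(G).
  by move=> Gx Gy; rewrite (subsetP sG'T) ?mem_commg.
have MR x y : x \in G -> y \in G -> [~ x, y] \in 'Mho^1(G).
  by move=> Gx Gy; rewrite (subsetP sTM) ?TR.
have R2 x y : x \in G -> y \in G ->
    [~ x ^+ 2, y] = [~ x, y] ^+ 2 * [~ [~ x, y], x].
  move=> Gx Gy; rewrite (commg_expgl_class2 2) ?expg1 //.
    by apply: cR => //; apply: MR.
  by apply: cR => //; rewrite ?GM ?MR.
have R4 x y : x \in G -> y \in G -> [~ x ^+ 4, y] = [~ x ^+ 2, y] ^+ 2.
  move=> Gx Gy; rewrite -[4]/(2 * 2)%N expgM commXg //.
  by apply: cR; rewrite ?Mx2 ?groupX.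
have cT : 'Mho^2(G) \subset 'C(G).
  (* The square of [g^2, y]^2 is [(g^2)^4, y]. *)
  have R4sq x y : x \in G -> y \in G -> [~ x ^+ 4, y] ^+ 2 = 1.
    move=> Gx Gy; rewrite R4 // -expgM -commXg; first last.
      by apply: cR; rewrite ?Mx2 ?groupX.
    by rewrite (M4 _ (Mx2 _ Gx)) comm1g.
  have Tsq d g : d \in 'Mho^2(G) -> g \in G -> [~ d, g] ^+ 2 = 1.
    move=> Td Gg; apply/eqP; move: d Td.
    apply: (@pgroup_Mho_ind 2 2 _ G (fun d => [~ d, g] ^+ 2 == 1)) => //.
    - by rewrite comm1g expg1n.
    - move=> u v /(subsetP sTM) Mu /(subsetP sTM) Mv /eqP u2 /eqP v2.
      have /commgP/conjg_fixP cuv := commute_sym (cR u g v Mu Gg (GM v Mv)).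
      rewrite commMgJ cuv expgMn ?u2 ?v2 ?mulg1 //.
      by apply: cR => //; apply: groupR => //; apply: GM.
    by move=> x Gx; rewrite R4sq.
  apply/(pgroup_Mho_subP _ _ pG) => x Gx; apply/centP=> y Gy; apply/commgP.
  rewrite R4 // R2 // expgMn; last by apply: cR; rewrite ?groupX // ?GM ?MR.
  by rewrite -expgM M4 ?MR // Tsq ?TR // mulg1.
have T2 u : u \in 'Mho^2(G) -> u ^+ 2 = 1.
  have abT : abelian 'Mho^2(G) := subset_trans cT (centS (Mho_sub _ _)).
  move=> Tu; apply/eqP; move: u Tu.
  apply: (@pgroup_Mho_ind 2 2 _ G (fun u => u ^+ 2 == 1)) => //.
  - by rewrite expg1n eqxx.
  - move=> u v Tu Tv /eqP u2 /eqP v2.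
    by rewrite expgMn ?u2 ?v2 ?mulg1 //; apply: (centsP abT).
  by move=> x Gx; rewrite -expgM mulnC (expgM x 2) M4 ?Mx2.
apply/(pgroup_Mho_subP _ _ pG) => x Gx; rewrite expn1.
apply/centP=> y Gy; apply/commgP.
rewrite R2 // T2 ?TR // mul1g; apply/commgP.
exact: (centP (subsetP cT _ (TR x y Gx Gy)) x).
Qed.

Lemma Mho1_central (p : nat) (gT : finGroupType) (G : {group gT}) :
    prime p -> p.-group G -> [~: G, G] \subset 'Mho^(power_depth p)(G) ->
    'Mho^(power_depth p)('Mho^1(G)) \subset [1] ->
    [~: 'Mho^1(G), G] \subset 'C(G) ->
  'Mho^1(G) \subset 'C(G).
Proof.
rewrite /power_depth => p_pr; have [->|p_odd] := even_prime p_pr.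
  exact: Mho1_central_even.
have -> : (p == 2) = false by case: eqP p_odd => [->|].
exact: Mho1_central_odd.
Qed.

(** Write L = [M, G] and A = 'Mho^e(M).  Modulo A [L, G] the hypotheses of
    [Mho1_central] hold, so L is contained in A [L, G].  In the nilpotent group
    G / A, a normal subgroup contained in its own commutator with the group is
    trivial, so L is contained in A. *)
Lemma powerful_comm_Mho1 (p : nat) (gT : finGroupType) (G : {group gT}) :
    prime p -> p.-group G -> powerful p G ->
  [~: 'Mho^1(G), G] \subset 'Mho^(power_depth p)('Mho^1(G)).
Proof.
move=> p_pr pG; rewrite (powerfulE pG); set e := power_depth p => sG'.
have nMG : G \subset 'N('Mho^1(G)) := normal_norm (Mho_normal 1 G).
pose A := 'Mho^e('Mho^1(G))%G; pose L := [~: 'Mho^1(G), G]%G.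
have nAG : G \subset 'N(A).
  exact: char_norm (char_trans (Mho_char e _) (Mho_char 1 G)).
have sLG : L \subset G by rewrite comm_subG ?Mho_sub.
have nRG : G \subset 'N([~: L, G]).
  by rewrite (subset_trans _ (commg_norm _ _)) ?joing_subr.
pose Q := (A <*> [~: L, G])%G.
have nQG : G \subset 'N(Q) by rewrite normsY.
have nQM := subset_trans (Mho_sub 1 G) nQG.
have sLQ : L \subset Q.
  rewrite /L -quotient_cents2 // [in X in X \subset _]/quotient morphim_Mho //.
  apply: (Mho1_central p_pr); rewrite ?quotient_pgroup //.
  - by rewrite -quotientR // -morphim_Mho // quotientS.
  - by rewrite -!morphim_Mho // quotient_sub1 ?joing_subl //
      (subset_trans (Mho_sub _ _)).
  rewrite -morphim_Mho // -quotientR // quotient_cents2 ?joing_subr //.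
  exact: subset_trans nQG.
have nAL := subset_trans sLG nAG.
have /forall_inP/(_ (L / A)%G) := quotient_nil A (pgroup_nil pG).
rewrite subsetI quotientS //= -quotientR //.
have -> : (L / A \subset [~: L, G] / A).
  apply: subset_trans (quotientS A sLQ) _.
  rewrite quotientYidl //.
  exact: subset_trans (comm_subG sLG (subxx _)) nAG.
by move=> /(_ isT)/eqP LA1; rewrite -quotient_sub1 // LA1.
Qed.

(** * Power maps in a powerful p-group *)

Lemma powerful_Mho1 (p : nat) (gT : finGroupType) (G : {group gT}) :
  prime p -> p.-group G -> powerful p G -> powerful p 'Mho^1(G).
Proof.
move=> p_pr pG powG; rewrite (powerfulE (pgroupS (Mho_sub 1 G) pG)).
by rewrite (subset_trans _ (powerful_comm_Mho1 p_pr pG powG)) ?commgS ?Mho_sub.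
Qed.

(** Modulo [M, G] the factor M of H = <x>M becomes central, so [H, H] is
    contained in [M, G], which is contained in 'Mho^e(M) and so in 'Mho^e(H). *)
Lemma powerful_cycle_Mho1 (p : nat) (gT : finGroupType) (G : {group gT}) x :
    prime p -> p.-group G -> powerful p G -> x \in G ->
  powerful p (<[x]> <*> 'Mho^1(G)).
Proof.
move=> p_pr pG powG Gx; pose H := (<[x]> <*> 'Mho^1(G))%G.
have sMG := Mho_sub 1 G.
have sHG : H \subset G by rewrite join_subG cycle_subG Gx.
have sRG : [~: 'Mho^1(G), G] \subset G by rewrite comm_subG.
have nRG : G \subset 'N([~: 'Mho^1(G), G]).
  by rewrite (subset_trans _ (commg_norm _ _)) ?joing_subr.
rewrite (powerfulE (pgroupS sHG pG)).
have sMH : 'Mho^1(G) \subset H by apply: joing_subr.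
apply: subset_trans (subset_trans _ (powerful_comm_Mho1 p_pr pG powG)) (MhoS _ sMH).
have nRx : <[x]> \subset 'N([~: 'Mho^1(G), G]) by rewrite cycle_subG (subsetP nRG).
have nRM := subset_trans sMG nRG.
rewrite -quotient_cents2 ?(subset_trans sHG) //= quotientY //.
rewrite -/(abelian _) abelianY quotient_abelian ?cycle_abelian //=.
rewrite /abelian !quotient_cents2 //=.
by rewrite !commgS // cycle_subG.
Qed.

(** M lies in the Frattini subgroup, so <x>M = G would make G cyclic. *)
Lemma cycle_Mho1_proper (p : nat) (gT : finGroupType) (G : {group gT}) x :
  p.-group G -> ~~ abelian G -> x \in G -> <[x]> <*> 'Mho^1(G) \proper G.
Proof.
move=> pG nabG Gx; rewrite properE join_subG cycle_subG Gx Mho_sub /=.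
apply: contra nabG => sGH; apply: cyclic_abelian; apply/cyclicP; exists x.
rewrite -[<[x]>]genGid; apply/esym/Phi_nongen/eqP.
rewrite eqEsubset join_subG Phi_sub cycle_subG Gx /=.
apply: subset_trans sGH _; rewrite join_subG joing_subr (Phi_joing pG) /=.
by rewrite (subset_trans (joing_subr _ _) (joing_subl _ _)).
Qed.

(** Write D for (G^p)^p.  As [M, G] is contained in D, G / D has class at most
    2, and the correction term [y, x]^{p(p-1)/2} is in D: for odd p because
    [y, x] is in M, for p = 2 because [y, x] is in G^4. *)
Lemma powerful_expgM_mod (p : nat) (gT : finGroupType) (G : {group gT}) :
    prime p -> p.-group G -> powerful p G ->
  {in G &, {morph (fun x => coset 'Mho^1('Mho^1(G)) (x ^+ p)) : x y / x * y}}.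
Proof.
move=> p_pr pG powG x y Gx Gy; set M := 'Mho^1(G)%G; set D := 'Mho^1(M)%G.
have pM : p.-group M := pgroupS (Mho_sub 1 G) pG.
have sG' : [~: G, G] \subset 'Mho^(power_depth p)(G) by rewrite -powerfulE.
have nDG : G \subset 'N(D) := char_norm (char_trans (Mho_char 1 _) (Mho_char 1 G)).
have sMD : [~: M, G] \subset D.
  exact: subset_trans (powerful_comm_Mho1 p_pr pG powG) (Mho_leq _ _).
have cMD : M / D \subset 'C(G / D) by apply: quotient_cents2r.
have [Nx Ny] := (subsetP nDG x Gx, subsetP nDG y Gy).
have Mc : [~ y, x] \in M.
  by rewrite (subsetP (subset_trans sG' (Mho_leq G _))) ?mem_commg.
have Nc := subsetP nDG _ (groupR Gy Gx).
have cc z : z \in G -> commute (coset D z) (coset D [~ y, x]).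
  move=> Gz; apply/commute_sym/(centsP cMD); exact: mem_quotient.
rewrite !morphX ?groupM // morphM // expMg_Rmul -?morphR //; try exact: cc.
suffices -> : coset D [~ y, x] ^+ 'C(p, 2) = 1 by rewrite mulg1.
have [p2 | p_odd] := even_prime p_pr; last first.
  have /dvdnP[k ->] : p %| 'C(p, 2).
    by apply: prime_dvd_bin => //=; case: (p) p_odd p_pr => [|[|[|]]].
  have: coset D ([~ y, x] ^+ p) = 1 by apply/coset_id/(pgroup_expg_Mho 1 pM).
  by rewrite mulnC expgM morphX // => ->; rewrite expg1n.
rewrite p2 expg1 coset_id //.
have: [~ y, x] \in 'Mho^2(G).
  by rewrite p2 in sG'; rewrite (subsetP sG') ?mem_commg.
apply/subsetP/(pgroup_Mho_subP _ _ pG) => z Gz.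
rewrite expnS expgM -[X in _ ^+ X]expn1.
by apply/(pgroup_expg_Mho 1 pM)/(pgroup_expg_Mho 1 pG).
Qed.

(** By [powerful_expgM_mod], an element of M is x^p v with v in M^p.  Both
    factors lie in H^p for the powerful subgroup H = <x>M, which is
    proper unless G is abelian, so induction applies to H. *)
Lemma powerful_Mho1_expg (p : nat) (gT : finGroupType) (G : {group gT}) u :
    prime p -> p.-group G -> powerful p G -> u \in 'Mho^1(G) ->
  exists2 x, x \in G & u = x ^+ p.
Proof.
move=> p_pr; have [n leGn] := ubnP #|G|; elim: n => // n IHn in G leGn u *.
move=> pG powG Mu; have [abG | nabG] := boolP (abelian G).
  by have:= Mu; rewrite (MhoEabelian 1 pG abG) => /imsetP.
set M := 'Mho^1(G)%G; set D := 'Mho^1(M)%G.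
have pM : p.-group M := pgroupS (Mho_sub 1 G) pG.
have nDG : G \subset 'N(D) := char_norm (char_trans (Mho_char 1 _) (Mho_char 1 G)).
have: [exists x in G, coset D u == coset D (x ^+ p)].
  move: u Mu; apply: (@pgroup_Mho_ind p 1 _ G
    (fun u => [exists x in G, coset D u == coset D (x ^+ p)])) => //.
  - by apply/exists_inP; exists 1; rewrite ?group1 ?expg1n.
  - move=> u v Mu Mv /exists_inP[x Gx /eqP Dx] /exists_inP[y Gy /eqP Dy].
    apply/exists_inP; exists (x * y); first exact: groupM.
    rewrite powerful_expgM_mod // -Dx -Dy morphM //.
      by rewrite (subsetP nDG) ?(subsetP (Mho_sub 1 G)).
    by rewrite (subsetP nDG) ?(subsetP (Mho_sub 1 G)).
  by move=> x Gx; apply/exists_inP; exists x.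
case/exists_inP=> x Gx /eqP Dux; pose H := (<[x]> <*> M)%G.
have ltHG : H \proper G by apply: cycle_Mho1_proper pG nabG Gx.
have pH := pgroupS (proper_sub ltHG) pG.
have Hx : x \in H by rewrite mem_gen // inE cycle_id.
have [||y Hy ->] := IHn H (leq_trans (proper_card ltHG) leGn) u pH.
- exact: powerful_cycle_Mho1.
- have [||v Dv ->] := kercoset_rcoset _ _ Dux.
  + by rewrite (subsetP nDG) ?(subsetP (Mho_sub 1 G)).
  + by rewrite (subsetP nDG) ?groupX.
  rewrite groupM ?(pgroup_expg_Mho 1 pH) //.
  exact: subsetP (MhoS 1 (joing_subr _ _)) v Dv.
by exists y; rewrite // (subsetP (proper_sub ltHG)).
Qed.

Lemma powerful_Mho (p i : nat) (gT : finGroupType) (G : {group gT}) :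
    prime p -> p.-group G -> powerful p G ->
  [/\ powerful p 'Mho^i(G), 'Mho^1('Mho^i(G)) = 'Mho^i.+1(G)
    & {in 'Mho^i(G), forall u, exists2 x, x \in G & u = x ^+ (p ^ i)}].
Proof.
move=> p_pr pG powG; elim: i => [|i [powi Di Ei]].
  by rewrite !Mho0; split=> // u Gu; exists u.
have pMho j : p.-group 'Mho^j(G) := pgroupS (Mho_sub j G) pG.
have powS : powerful p 'Mho^i.+1(G).
  by rewrite -Di; apply: powerful_Mho1 (pMho i) powi.
have ES : {in 'Mho^i.+1(G), forall u, exists2 x, x \in G & u = x ^+ (p ^ i.+1)}.
  move=> u; rewrite -Di => /(powerful_Mho1_expg p_pr (pMho i) powi)[_ /Ei[x Gx ->] ->].
  by exists x; rewrite // -expgM -expnSr.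
split=> //; apply/eqP; rewrite eqEsubset; apply/andP; split.
  apply/(pgroup_Mho_subP _ _ (pMho _)) => _ /ES[x Gx ->].
  by rewrite -expgM -expnD addn1 (pgroup_expg_Mho _ pG).
apply/(pgroup_Mho_subP _ _ pG) => x Gx; rewrite expnSr expgM.
exact/(pgroup_expg_Mho 1 (pMho _))/(pgroup_expg_Mho _ pG).
Qed.

Lemma powerful_Mho_Mho1 (p i : nat) (gT : finGroupType) (G : {group gT}) :
    prime p -> p.-group G -> powerful p G ->
  'Mho^i('Mho^1(G)) = 'Mho^i.+1(G).
Proof.
move=> p_pr pG powG; have pM := pgroupS (Mho_sub 1 G) pG.
apply/eqP; rewrite eqEsubset; apply/andP; split.
  apply/(pgroup_Mho_subP _ _ pM) => _ /(powerful_Mho1_expg p_pr pG powG)[x Gx ->].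
  by rewrite -expgM -expnS (pgroup_expg_Mho _ pG).
apply/(pgroup_Mho_subP _ _ pG) => x Gx; rewrite expnS expgM.
exact/(pgroup_expg_Mho _ pM)/(pgroup_expg_Mho 1 pG).
Qed.

(** Iterates [powerful_expgM_mod] along the powerful groups 'Mho^i(G): the error
    term of step i lies in 'Mho^i.+1(G), and its p-th power in
    'Mho^i.+2(G). *)
Lemma powerful_expg_iter_mod (p i : nat) (gT : finGroupType) (G : {group gT}) :
    prime p -> p.-group G -> powerful p G ->
  {in G &, {morph (fun x => coset 'Mho^i.+1(G) (x ^+ (p ^ i))) : x y / x * y}}.
Proof.
move=> p_pr pG powG x y Gx Gy.
have nMho j : G \subset 'N('Mho^j(G)) := normal_norm (Mho_normal j G).
have NG j z : z \in G -> z \in 'N('Mho^j(G)) by apply: subsetP.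
elim: i => [|i IHi]; first by rewrite morphM ?NG.
have [powi Di _] := powerful_Mho i p_pr pG powG.
have [_ DSi _] := powerful_Mho i.+1 p_pr pG powG.
have pi := pgroupS (Mho_sub i G) pG.
have /= homi := powerful_expgM_mod p_pr pi powi; rewrite Di DSi in homi.
have Mi z : z \in G -> z ^+ (p ^ i) \in 'Mho^i(G) := pgroup_expg_Mho i pG.
have eq_xy : coset 'Mho^i.+1(G) ((x * y) ^+ (p ^ i))
           = coset 'Mho^i.+1(G) (x ^+ (p ^ i) * y ^+ (p ^ i)).
  by rewrite IHi morphM ?NG ?groupX.
have [||z Dz def_xy] := kercoset_rcoset _ _ eq_xy.
- by rewrite NG ?groupX ?groupM.
- by rewrite NG ?groupM ?groupX.
rewrite !expnSr !expgM def_xy homi ?groupM ?Mi //; last first.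
  exact: (subsetP (Mho_leq G (leqnSn i)) z Dz).
rewrite homi ?Mi // [coset _ (z ^+ p)]coset_id ?mul1g //.
by rewrite -DSi (pgroup_expg_Mho 1 (pgroupS (Mho_sub _ G) pG)).
Qed.

(** * Counting elements of bounded order *)

Lemma mem_Omega_set (p i : nat) (gT : finGroupType) (G : {group gT}) x :
    prime p -> p.-group G ->
  (x \in Omega_set p i G) = (x \in G) && (x ^+ (p ^ i) == 1).
Proof.
move=> p_pr pG; rewrite inE; apply: andb_id2l => Gx.
have /p_natP[k ox] : p.-nat #[x] := mem_p_elt pG Gx.
by rewrite -order_dvdn ox leq_exp2l ?dvdn_Pexp2l ?prime_gt1.
Qed.

Lemma card_Omega_abelian (p i : nat) (gT : finGroupType) (G : {group gT}) :
    prime p -> p.-group G -> abelian G ->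
  (#|Omega_set p i G| * #|'Mho^i(G)|)%N = #|G|.
Proof.
move=> p_pr pG abG; rewrite -(mul_card_Ohm_Mho_abelian i abG).
suffices -> : Omega_set p i G = 'Ohm_i(G) by [].
rewrite (OhmEabelian pG (abelianS (Ohm_sub i G) abG)).
by apply/setP=> x; rewrite mem_Omega_set // !inE.
Qed.

(** The kernel of the homomorphism of [powerful_expg_iter_mod]. *)
Definition power_kernel (p i : nat) (gT : finGroupType) (G : {set gT}) :
  {set gT} := [set x in G | x ^+ (p ^ i) \in 'Mho^i.+1(G)].

Lemma power_kernelP (p i : nat) (gT : finGroupType) (G : {group gT}) :
    prime p -> p.-group G -> powerful p G ->
  exists2 K : {group gT}, K :=: power_kernel p i G
    & (#|K| * #|'Mho^i(G)|)%N = (#|G| * #|'Mho^i.+1(G)|)%N.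
Proof.
move=> p_pr pG powG; pose f := Morphism (powerful_expg_iter_mod i p_pr pG powG).
have nMho j : G \subset 'N('Mho^j(G)) := normal_norm (Mho_normal j G).
have sSi : 'Mho^i.+1(G) \subset 'Mho^i(G) by apply: Mho_leq.
have [_ _ Ei] := powerful_Mho i p_pr pG powG.
have im_f : f @* G = 'Mho^i(G) / 'Mho^i.+1(G).
  apply/setP=> u; apply/morphimP/morphimP=> [[x Gx _ ->] | [z Nz /Ei[x Gx Dz] ->]].
    exists (x ^+ (p ^ i)) => //; last exact: pgroup_expg_Mho.
    by rewrite (subsetP (nMho _)) ?groupX.
  by exists x; rewrite //= Dz.
exists ('ker f)%G.
  apply/setP=> x; rewrite !inE; apply: andb_id2l => Gx /=.
  apply/eqP/idP=> [|Mx]; last exact: coset_id.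
  by apply: coset_idr; rewrite (subsetP (nMho _)) ?groupX.
rewrite -(Lagrange sSi) -(Lagrange (subsetIl G _ : 'ker f \subset G)) /=.
have := card_morphim f G; rewrite im_f setIid card_quotient => [->|].
  by rewrite -mulnA (mulnC #|_ : _|).
exact: subset_trans (Mho_sub i G) (nMho _).
Qed.

Lemma card_cycle_join (p : nat) (gT : finGroupType) (N : {group gT}) x :
    prime p -> x \in 'N(N) -> x ^+ p \in N -> x \notin N ->
  #|<[x]> <*> N| = (p * #|N|)%N.
Proof.
move=> p_pr Nx xpN notNx; have nNx : <[x]> \subset 'N(N) by rewrite cycle_subG.
rewrite -(Lagrange (joing_subr <[x]> N)) mulnC; congr (_ * _)%N.
rewrite -card_quotient ?join_subG ?nNx ?normG //= quotientYidr //.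
rewrite quotient_cycle // -orderE; apply: nt_prime_order => //.
  by rewrite -morphX //; apply: coset_id.
by apply: contra notNx => /eqP; apply: coset_idr.
Qed.

(** Outside N, the relation y \in <[x]> <*> N is symmetric because both joins
    have order p |N|.  Counting the related pairs in A x B in two ways gives the
    equality. *)
Lemma double_count_cycle_join (p a b : nat) (gT : finGroupType)
    (G N : {group gT}) (A B : {set gT}) :
    prime p -> N <| G -> {in G, forall x, x ^+ p \in N} ->
    A \subset G :\: N -> B \subset G :\: N ->
    {in A, forall x, #|B :&: (<[x]> <*> N)| = b} ->
    {in B, forall x, #|A :&: (<[x]> <*> N)| = a} ->
  (#|A| * b)%N = (#|B| * a)%N.
Proof.
move=> p_pr /andP[sNG nNG] GpN /subsetP sAG /subsetP sBG Ab Ba.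
have symR : {in G :\: N &, forall x y,
    y \in <[x]> <*> N -> x \in <[y]> <*> N}.
  move=> x y /setDP[Gx notNx] /setDP[Gy notNy] xy.
  have sYX : <[y]> <*> N \subset <[x]> <*> N.
    by rewrite join_subG cycle_subG xy joing_subr.
  have /eqP -> : <[y]> <*> N == <[x]> <*> N.
    by rewrite eqEcard sYX !(card_cycle_join p_pr) ?GpN ?(subsetP nNG) /=.
  by rewrite mem_gen // inE cycle_id.
rewrite -sum_nat_const -[RHS]sum_nat_const.
transitivity (\sum_(x in A) \sum_(y in B :&: (<[x]> <*> N)) 1)%N.
  by apply: eq_bigr => x Ax; rewrite sum1_card Ab.
transitivity (\sum_(y in B) \sum_(x in A :&: (<[y]> <*> N)) 1)%N; last first.
  by apply: eq_bigr => y By; rewrite sum1_card Ba.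
rewrite (exchange_big_dep (mem B)) /=; last by move=> x y _ /setIP[].
apply: eq_bigr => y By; apply: eq_bigl => x; rewrite !inE By /=.
apply: andb_id2l => Ax; have [Gx Gy] := (sAG x Ax, sBG y By).
by apply/idP/idP; apply: symR.
Qed.

(** With N for the subgroup of p-th powers, O for the elements of order at most
    p^i and m = |O :&: N|, the pairs (x, y) in (K :\: N) x (O :\: N) such that
    <x>N = <y>N are counted twice: each x has (p - 1) m partners by induction
    applied to <x>N, and each y has (p - 1) |N| of them because <y>N is
    contained in K. *)
Lemma card_Omega_powerful (p i : nat) (gT : finGroupType) (G : {group gT}) :
    prime p -> p.-group G -> powerful p G ->
  (#|Omega_set p i G| * #|'Mho^i(G)|)%N = #|G|.
Proof.
move=> p_pr; have [n leGn] := ubnP #|G|; elim: n => // n IHn in G leGn *.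
move=> pG powG; have [abG | nabG] := boolP (abelian G).
  exact: card_Omega_abelian.
pose N := 'Mho^1(G)%G; have nNG : N <| G := Mho_normal 1 G.
have sNG := normal_sub nNG.
have NX x : x \in G -> x ^+ p \in N := pgroup_expg_Mho 1 pG.
have memO (H : {group gT}) x : H \subset G ->
    (x \in Omega_set p i H) = (x \in H) && (x ^+ (p ^ i) == 1).
  by move=> sHG; apply: mem_Omega_set (pgroupS sHG pG).
have IH (H : {group gT}) : H \proper G -> powerful p H ->
    (#|Omega_set p i H| * #|'Mho^i(H)|)%N = #|H|.
  move=> ltHG; have sHG := proper_sub ltHG; apply: IHn (pgroupS sHG pG).
  exact: leq_trans (proper_card ltHG) leGn.
have ltHG x : x \in G -> <[x]> <*> N \proper G := cycle_Mho1_proper pG nabG.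
have ltNG : N \proper G := sub_proper_trans (joing_subr _ _) (ltHG 1 (group1 G)).
have DN : 'Mho^i(N) = 'Mho^i.+1(G) := powerful_Mho_Mho1 i p_pr pG powG.
have cardN := IH N ltNG (powerful_Mho1 p_pr pG powG).
have [K defK cardK] := power_kernelP i p_pr pG powG.
have memK x : (x \in K) = (x \in G) && (x ^+ (p ^ i) \in 'Mho^i.+1(G)).
  by rewrite defK inE.
have sNK : N \subset K.
  apply/subsetP=> x Nx; rewrite memK (subsetP sNG) //= -DN.
  exact: pgroup_expg_Mho (pgroupS sNG pG) Nx.
have sKG : K \subset G by apply/subsetP=> x; rewrite memK => /andP[].
have sOK : Omega_set p i G \subset K.
  by apply/subsetP=> x; rewrite memO // memK => /andP[-> /eqP->]; rewrite /= group1.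
set O := Omega_set p i G; set m := #|Omega_set p i N| in cardN.
have ON : O :&: N = Omega_set p i N.
  apply/setP=> x; rewrite inE !memO // andbC.
  by have [Nx | //] := boolP (x \in N); rewrite (subsetP sNG).
have OH x : x \in K :\: N -> #|(O :\: N) :&: (<[x]> <*> N)| = (p.-1 * m)%N.
  move=> /setDP[Kx notNx]; have Gx := subsetP sKG x Kx.
  pose H := (<[x]> <*> N)%G; have sHG := proper_sub (ltHG x Gx).
  have sHK : H \subset K by rewrite join_subG cycle_subG Kx.
  have sNH : N \subset H by apply: joing_subr.
  (* From below because H contains N, from above because H is contained in K. *)
  have DH : 'Mho^i(H) = 'Mho^i.+1(G).
    apply/eqP; rewrite eqEsubset -{2}DN MhoS // andbT.
    apply/(pgroup_Mho_subP _ _ (pgroupS sHG pG)) => y /(subsetP sHK).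
    by rewrite memK => /andP[].
  have cardH : #|Omega_set p i H| = (p * m)%N.
    have := IH H (ltHG x Gx) (powerful_cycle_Mho1 p_pr pG powG Gx).
    rewrite DH (card_cycle_join p_pr) ?NX ?(subsetP (normal_norm nNG)) //.
    by rewrite -cardN DN mulnA => /eqP; rewrite eqn_pmul2r // => /eqP.
  rewrite -subn1 mulnBl mul1n -cardH setIDAC -[X in (_ :&: X) :\: _]/(gval H).
  have -> : O :&: H = Omega_set p i H.
    apply/setP=> y; rewrite inE !memO // andbC.
    by have [Hy | //] := boolP (y \in H); rewrite (subsetP sHG).
  rewrite cardsD; congr (_ - #|pred_of_set _|); apply/setP=> y.
  rewrite inE !memO // andbC.
  by have [Ny | //] := boolP (y \in N); rewrite (subsetP sNH).
have KH x : x \in O :\: N -> #|(K :\: N) :&: (<[x]> <*> N)| = (p.-1 * #|N|)%N.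
  move=> /setDP[Ox notNx]; have Kx := subsetP sOK x Ox.
  have Gx := subsetP sKG x Kx.
  rewrite setIDAC (setIidPr _) ?join_subG ?cycle_subG ?Kx //.
  rewrite cardsD (setIidPr (joing_subr _ _)).
  rewrite (card_cycle_join p_pr) ?NX ?(subsetP (normal_norm nNG)) //.
  by rewrite -subn1 mulnBl mul1n.
have p1_gt0 : 0 < p.-1 by rewrite -ltnS prednK ?prime_gt1 ?prime_gt0.
have := double_count_cycle_join p_pr nNG NX
  (setSD _ sKG) (setSD _ (subset_trans sOK sKG)) OH KH.
rewrite mulnCA [in RHS]mulnCA => /eqP; rewrite eqn_pmul2l // => /eqP cardOK.
have cardO : (#|O| * #|N| = #|K| * m)%N.
  rewrite -(cardsID N O) ON -/m mulnDl -cardOK -(cardsID N K) (setIidPr sNK).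
  by rewrite mulnDl mulnC.
apply/eqP; rewrite -(eqn_pmul2r (cardG_gt0 N)) mulnAC cardO.
by rewrite mulnAC cardK -mulnA (mulnC _ m) -DN cardN.
Qed.

Theorem theorem4 (p : nat) (gT : finGroupType) (G : {group gT})
    (p_prime : prime p) (pG : p.-group G) (powG : powerful p G) (i : nat) :
  #|G : power_subgroup G (p ^ i)%N| = #|Omega_set p i G|.
Proof.
rewrite (power_subgroup_Mho i pG); apply/eqP.
rewrite -(eqn_pmul2r (cardG_gt0 'Mho^i(G))) mulnC Lagrange ?Mho_sub //.
by rewrite card_Omega_powerful.
Qed.
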